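(* Let $K:\mathcal X\to\mathcal Y$ be a compact linear operator with $\|K\|=1$, let $\{\alpha_k\}_{k\in\mathbb N}$ and $\{r_k\}_{k\in\mathbb N}$ be sequences of positive real numbers, let $y$ be attainable and $x^\dagger=K^\dagger y\in\mathcal X_\nu$ for some $\nu>0$, and let $x_{\alpha_n,r_n}^n$ be the iterates of the nonstationary iterated weighted Tikhonov (NSIWT) method. Define $$\beta_n=\sum_{k=1}^n\alpha_k^{-1},\qquad\tilde\beta_n=\sum_{k=1}^n\frac1{1+\alpha_k}.$$ (i) If $\sup_{k\in\mathbb N}r_k=r\in[0,\infty)$ and $\lim_{n\to\infty}\beta_n=\infty$, then $$\|x^\dagger-x_{\alpha_n,r_n}^n\|=\begin{cases}o\big(\beta_n^{-\frac{\nu}{r+1}}\big)&\text{if }\lim_{n\to\infty}\alpha_n=\alpha\in(0,\infty],\\ O\big(\beta_n^{-\frac{\nu}{r+1}}\big)&\text{if }\lim_{n\to\infty}\alpha_n=0\text{ and }\alpha_n^{-1}\le c\,\beta_{n-1}\text{ for some constant }c>0,\\ o\big(\tilde\beta_n^{-\frac{\nu}{r+1}}\big)&\text{otherwise.}\end{cases}$$ (ii) If $r_k\to\infty$ monotonically and $\beta_n^{-1}=o(\sigma^{r_n+1})$ as $n\to\infty$ for every $\sigma\in\sigma(K)\setminus\{0\}$, then $$\|x^\dagger-x_{\alpha_n,r_n}^n\|=o\big(\beta_n^{-\frac{\nu}{r_n+1}}\big).$$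
   Context: $\mathcal X,\mathcal Y$ are Hilbert spaces; $y$ attainable means $y\in R(K)$; $K^\dagger$ is the Moore-Penrose generalized inverse. $(\sigma_m;v_m,u_m)$ is the singular value expansion of $K$ ($Kv_m=\sigma_mu_m$, $K^*u_m=\sigma_mv_m$, $\sigma_m>0$ decreasing), so $\sigma_1=\|K\|=1$; $\sigma(K)$ denotes the closure of $\{\sigma_m\}$. $\mathcal X_\nu=\{x\in\mathcal X:\ x=(K^*K)^{\nu/2}\omega\text{ for some }\omega\in\mathcal X\}$. The condition $\alpha_n^{-1}\le c\,\beta_{n-1}$ is understood for all $n\ge2$. NSIWT: $x_{\alpha_0,r_0}^0=0$ and, for $n\ge1$, $$\big[(K^*K)^{\frac{r_n+1}2}+\alpha_nI\big]x_{\alpha_n,r_n}^n=(K^*K)^{\frac{r_n-1}2}K^*y+\alpha_nx_{\alpha_{n-1},r_{n-1}}^{n-1},$$ where $(K^*K)^{\frac{r-1}2}K^*y:=\sum_m\sigma_m^{r}\langle y,u_m\rangle v_m$. *)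

(* Defs.v *)
From HB Require Import structures.
From mathcomp Require Import all_boot all_order all_algebra.
From mathcomp Require Import all_classical all_reals all_analysis.
From mathcomp Require Import complex.

Set Implicit Arguments.
Unset Strict Implicit.
Unset Printing Implicit Defensive.

Import Order.TTheory GRing.Theory Num.Theory.
Import numFieldNormedType.Exports.

Local Open Scope classical_set_scope.
Local Open Scope ring_scope.

(* The scalar field of a Hilbert space: the real numbers R, or R[i]. *)
Inductive scalar_kind := RealScalars | ComplexScalars.

Section Scalars.
Variables (R : realType) (k : scalar_kind).

Definition scalars : numFieldType :=
  match k with RealScalars => R | ComplexScalars => R[i]%type end.

Definition sconj : scalars -> scalars :=
  match k return
    (match k with RealScalars => R | ComplexScalars => R[i]%type end
       : numFieldType) ->
    (match k with RealScalars => R | ComplexScalars => R[i]%type end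
       : numFieldType)
  with RealScalars => id | ComplexScalars => @conjc R end.

Definition of_real : R -> scalars :=
  match k return R ->
    (match k with RealScalars => R | ComplexScalars => R[i]%type end
       : numFieldType)
  with RealScalars => id | ComplexScalars => real_complex R end.

Definition real_part : scalars -> R :=
  match k return
    (match k with RealScalars => R | ComplexScalars => R[i]%type end
       : numFieldType) -> R
  with RealScalars => id | ComplexScalars => @complex.Re R end.

End Scalars.

(* [inner] is linear in its first argument and conjugate-linear in the
   second. *)
Record hilbert (R : realType) (k : scalar_kind) := Hilbert {
  hspace :> completeNormedModType (scalars R k) ;
  inner : {dot hspace for @sconj R k} ;
  innerE : forall x : hspace, inner x x = `|x| ^+ 2 }.

(* MathComp-Analysis norms take values in the scalar field, hence in R[i] for a
   complex space; [hnorm] is the same norm seen as a real number. *)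
Definition hnorm (R : realType) (k : scalar_kind) (X : hilbert R k) (x : X) : R :=
  real_part (`|x| : scalars R k).

Section Operators.
Variables (R : realType) (k : scalar_kind) (X Y : hilbert R k).
Variable K : {linear X -> Y}.

Definition opnorm : R := sup [set hnorm (K x) | x in [set x | hnorm x <= 1]].

Definition compact_operator : Prop :=
  forall B : set X, bounded_set B -> precompact (K @` B).

(* K^* y is the unique x with <K z, y> = <z, x> for all z; it exists for bounded
   K by Riesz representation. *)
Definition adjoint (y : Y) : X :=
  xget 0 [set x | forall z, inner Y (K z) y = inner X z x].

(* The Moore-Penrose inverse is the linear extension, by 0 on R(K)^_|_, of the
   inverse of K : N(K)^_|_ -> R(K).  Thus K^+ y is the x in N(K)^_|_ with
   y = K x + y' for some y' in R(K)^_|_; such an x is unique, and it exists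
   exactly for y in R(K) + R(K)^_|_.  Outside that domain the value is 0. *)
Definition pseudoinverse (y : Y) : X :=
  xget 0 [set x | (forall z, K z = 0 -> inner X x z = 0) /\
    exists2 y', (forall z, inner Y y' (K z) = 0) & y = K x + y'].

(* Singular values are indexed from 0.  [sidx] is all of nat, or an initial
   segment of it when K has finite rank; the values of [sval_], [rvec] and
   [lvec] outside [sidx] are irrelevant. *)
Record sve := Sve {
  sidx : set nat ;
  sval_ : nat -> R ;
  rvec : nat -> X ;
  lvec : nat -> Y ;
  sidx_initial : forall m n, (m <= n)%N -> sidx n -> sidx m ;
  sval_gt0 : forall m, sidx m -> 0 < sval_ m ;
  sval_decr : forall m n, (m <= n)%N -> sidx n -> sval_ n <= sval_ m ;
  rvec_orthonormal : forall m n, sidx m -> sidx n ->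
    inner X (rvec m) (rvec n) = (m == n)%:R ;
  lvec_orthonormal : forall m n, sidx m -> sidx n ->
    inner Y (lvec m) (lvec n) = (m == n)%:R ;
  sve_right : forall m, sidx m -> K (rvec m) = of_real k (sval_ m) *: lvec m ;
  sve_left : forall m, sidx m ->
    adjoint (lvec m) = of_real k (sval_ m) *: rvec m ;
  sve_expansion : forall x,
    (fun n => \sum_(0 <= m < n | m \in sidx)
       (of_real k (sval_ m) * inner X x (rvec m)) *: lvec m) @ \oo --> K x }.

Variable S : sve.

Definition spectrum : set R := closure [set sval_ S m | m in sidx S].

(* (K^* K)^t x = \sum_m sigma_m^(2t) <x, v_m> v_m, for t > 0. *)
Definition normal_pow (t : R) (x : X) : X :=
  limn (fun n => \sum_(0 <= m < n | m \in sidx S)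
    (of_real k (sval_ S m `^ (2 * t)) * inner X x (rvec S m)) *: rvec S m).

(* (K^* K)^((r-1)/2) K^* y = \sum_m sigma_m^r <y, u_m> v_m, for r > 0. *)
Definition weighted_adjoint (r : R) (y : Y) : X :=
  limn (fun n => \sum_(0 <= m < n | m \in sidx S)
    (of_real k (sval_ S m `^ r) * inner Y y (lvec S m)) *: rvec S m).

Definition source_space (nu : R) : set X := range (normal_pow (nu / 2)).

(* [alpha] and [r] are used at indices >= 1 only. *)
Definition NSIWT (alpha r : nat -> R) (y : Y) (x : nat -> X) : Prop :=
  x 0%N = 0 /\
  forall n, (1 <= n)%N ->
    normal_pow ((r n + 1) / 2) (x n) + of_real k (alpha n) *: x n =
    weighted_adjoint (r n) y + of_real k (alpha n) *: x n.-1.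

End Operators.

Definition beta (R : realType) (alpha : nat -> R) (n : nat) : R :=
  \sum_(1 <= j < n.+1) (alpha j)^-1.

Definition beta_tilde (R : realType) (alpha : nat -> R) (n : nat) : R :=
  \sum_(1 <= j < n.+1) (1 + alpha j)^-1.

(* The limit of alpha exists and lies in ]0, +oo]. *)
Definition alpha_lim_pos (R : realType) (alpha : nat -> R) : Prop :=
  exists2 a : \bar R, (0 < a)%E & (alpha n)%:E @[n --> \oo] --> a.

Definition alpha_lim0_controlled (R : realType) (alpha : nat -> R) : Prop :=
  alpha n @[n --> \oo] --> (0 : R) /\
  exists2 c : R, 0 < c &
    forall n, (2 <= n)%N -> (alpha n)^-1 <= c * beta alpha n.-1.

(* Main.v *)
Require Import Defs.
From HB Require Import structures.
From mathcomp Require Import all_boot all_order all_algebra.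
From mathcomp Require Import all_classical all_reals all_analysis.
From mathcomp Require Import complex lra ring.

(** The singular system diagonalizes both the source condition and the
    iteration.  With e_n the error and x^+ = K^+ y = (K^* K)^(nu/2) w, pairing
    the defining equation with v_m and using <y, u_m> = sigma_m <x^+, v_m>
    gives (sigma_m^(r_n + 1) + alpha_n) <e_n, v_m> = alpha_n <e_(n-1), v_m>,
    hence ([inner_err])

      <e_n, v_m> = sigma_m^nu <w, v_m> / D_n(sigma_m),
      D_n(s) = (1 + s^(r_1 + 1) / alpha_1) ... (1 + s^(r_n + 1) / alpha_n).

    Both x^+ and the iterates lie in the closed span of the v_m, so |e_n|^2 is
    at most any bound on the partial sums of |<e_n, v_m>|^2.  As the sum over m
    of |<w, v_m>|^2 is finite, dominated convergence for series reduces
    phi_n |e_n| -> 0 to two facts about g_n(s) = phi_n s^nu / D_n(s)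
    ([err_decay]): it is bounded uniformly in n and in s among the singular
    values, and it tends to 0 for each fixed singular value s.

    Bounded orders.  As sigma_m <= 1 and r_j <= rho, one has
    D_n(sigma) >= P_n(s) with s = sigma^(rho + 1), where P_n(s) is the product
    of the 1 + s b_j, for any b_j <= 1 / alpha_j.  Let B_n be the sum of the
    b_j and p = nu / (rho + 1), so that B_n^p sigma^nu = (s B_n)^p.  If
    b_n <= c B_(n-1), then (s B_n)^p <= M P_n(s) for every p >= 0
    ([powR_sum_le_prod]): passing from n - 1 to n multiplies the left side by
    (1 + b_n / B_(n-1))^p <= 1 + C b_n / B_(n-1), which is at most the new
    factor 1 + s b_n of P_n once s B_(n-1) >= C.  The exponent p gives the
    uniform bound, and the exponent p + 1 gives the decay
    (s B_n)^p / P_n(s) <= M' / (s B_n) at fixed s.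

    All three regimes are instances of this.  A positive limit of alpha bounds
    it below, so 1 / alpha_n is bounded and thus controlled by beta_(n-1); the
    second regime is the control hypothesis itself, and the argument yields
    the little-o there as well; in the third, b_j = 1 / (1 + alpha_j) <= 1 is
    always controlled, and its sums diverge with beta_n ([beta_tilde_cvgy]).

    Unbounded orders.  By monotonicity of r, D_n(sigma) >= 1 + t with
    t = sigma^(r_n + 1) beta_n, while beta_n^p sigma^nu = t^p for
    p = nu / (r_n + 1), which is eventually at most 1/2.  Then
    t^p / (1 + t) <= 1, and it tends to 0 because t tends to infinity. *)

Set Implicit Arguments.
Unset Strict Implicit.
Unset Printing Implicit Defensive.

Import Order.TTheory GRing.Theory Num.Theory.
Import numFieldNormedType.Exports.

Local Open Scope classical_set_scope.
Local Open Scope ring_scope.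

(** * Real estimates *)

(** What [n] steps of the iteration divide the component of the error along a
    singular vector by, when its singular value is [s]. *)
Definition damping (R : realType) (alpha r : nat -> R) (s : R) (n : nat) : R :=
  \prod_(1 <= j < n.+1) (1 + s `^ (r j + 1) / alpha j).

Section RealEstimates.
Variable R : realType.
Implicit Types (a b W : nat -> R) (p c s t : R).

(** Dominated convergence for series: a tail of [W] absorbs all but finitely
    many terms, uniformly in [n], and those few tend to 0.  The bound is on all
    partial sums, so that no sum of the series [a n] has to be named. *)
Lemma tannery (a : nat -> nat -> R) W : cvgn (series W) ->
  (\forall n \near \oo, forall m, 0 <= a n m <= W m) ->
  (forall m, a n m @[n --> \oo] --> 0) ->
  forall eps, 0 < eps ->
  \forall n \near \oo, forall N, \sum_(0 <= m < N) a n m <= eps.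
Proof.
move=> /cauchy_cvgP/cauchy_seriesP Wtail aW a0 eps eps0.
have eps20 : 0 < eps / 2 by lra.
have [[P Q] [/= [i _ iP] [j _ jQ]] PQ] := Wtail _ eps20.
pose M := maxn i j.
have WM N : (M <= N)%N -> \sum_(M <= m < N) W m <= eps / 2.
  move=> MN; apply: ltW; apply: le_lt_trans (PQ (M, N) _); first exact: ler_norm.
  split; [apply: iP|apply: jQ] => /=; first exact: leq_maxl.
  by apply: leq_trans MN; exact: leq_maxr.
have head N : \sum_(0 <= m < N) a n m @[n --> \oo] --> 0.
  elim: N => [|N IHN].
    apply: cvg_trans (@cvg_cst R 0 nat \oo _).
    by apply: near_eq_cvg; near=> n; rewrite big_geq.
  apply: cvg_trans (_ : \sum_(0 <= m < N) a n m + a n N @[n --> \oo] --> 0).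
    by apply: near_eq_cvg; near=> n; rewrite big_nat_recr.
  by rewrite -[X in _ --> X]addr0; apply: cvgD.
have headM := cvgr_le _ (head M) (eps / 2) eps20.
apply: filterS2 aW (headM _) => n {}aW h N.
have [MN|/ltnW NM] := leqP M N.
  rewrite (big_cat_nat _ MN)//= (splitr eps) lerD//.
  apply: le_trans (WM _ MN); apply: ler_sum => m _.
  by have /andP[] := aW m.
apply: le_trans (_ : \sum_(0 <= m < M) a n m <= _); last lra.
rewrite [leRHS](big_cat_nat _ NM)//= lerDl sumr_ge0// => m _.
by have /andP[] := aW m.
Unshelve. all: by end_near. Qed.

(** From [1 + t <= expR t] and [expR u <= 1 + u * expR u].  An affine majorant
    in [t] with value 1 at 0 is what a factor [1 + s * b j] can absorb. *)
Lemma powR_1D_le p c t : 0 <= p -> 0 <= t -> t <= c ->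
  (1 + t) `^ p <= 1 + p * expR (p * c) * t.
Proof.
move=> p0 t0 tc; have pt0 : 0 <= p * t by exact: mulr_ge0.
have le_exp : (1 + t) `^ p <= expR (p * t).
  rewrite /powR gt_eqF ?ler_expR; last lra.
  by apply: ler_wpM2l => //; apply: le_ln1Dx; lra.
apply: (le_trans le_exp).
have : expR (p * t) * (1 - p * t) <= 1.
  rewrite -[leRHS](expR0) -[in leRHS](subrr (p * t)) expRD ler_pM2l ?expR_gt0//.
  exact: expR_ge1Dx.
have : expR (p * t) * (p * t) <= expR (p * c) * (p * t).
  by rewrite ler_wpM2r// ler_expR ler_wpM2l.
lra.
Qed.

Section Products.
Variable b : nat -> R.
Hypothesis b_gt0 : forall j, (1 <= j)%N -> 0 < b j.

Local Notation B n := (\sum_(1 <= j < n.+1) b j).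
Local Notation P n s := (\prod_(1 <= j < n.+1) (1 + s * b j)).

Lemma partial_sum_ge n : (1 <= n)%N -> b 1 <= B n.
Proof.
move=> n1; rewrite big_ltn// lerDl big_nat sumr_ge0// => j /andP[j1 _].
by apply/ltW/b_gt0/ltnW.
Qed.

Lemma partial_sum_gt0 n : (1 <= n)%N -> 0 < B n.
Proof. by move=> n1; apply: lt_le_trans (partial_sum_ge n1); apply: b_gt0. Qed.

Lemma prod_1D_ge n s : 0 <= s -> 1 + s * B n <= P n s.
Proof.
move=> s0; have b0 j : (1 <= j)%N -> 0 <= s * b j.
  by move=> j1; rewrite mulr_ge0// ltW// b_gt0.
elim: n => [|n IHn]; first by rewrite !big_geq// mulr0 addr0.
rewrite big_nat_recr//= [leRHS]big_nat_recr//= mulrDr.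
have Bn : 0 <= s * B n.
  by rewrite mulr_ge0// big_nat sumr_ge0// => j /andP[j1 _]; apply/ltW/b_gt0.
have := b0 n.+1 isT; move: IHn.
move: (s * b n.+1) (P n s) (s * B n) Bn => u v w; nra.
Qed.

Lemma prod_1D_ge1 n s : 0 <= s -> 1 <= P n s.
Proof.
move=> s0; apply: le_trans (prod_1D_ge n s0); rewrite lerDl mulr_ge0//.
by rewrite big_nat sumr_ge0// => j /andP[j1 _]; apply/ltW/b_gt0.
Qed.

(** Induction on [n]: the ratio of the two sides does not increase as soon as
    [s * B n] exceeds the slope [C] of [powR_1D_le].  Before that, [s * B n] is
    bounded and the product is at least 1. *)
Lemma powR_sum_le_prod c p : 0 <= c -> 0 <= p ->
  (forall n, (2 <= n)%N -> b n <= c * B n.-1) ->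
  exists2 M, 0 <= M & forall n s, (1 <= n)%N -> 0 <= s <= 1 ->
    (s * B n) `^ p <= M * P n s.
Proof.
move=> c0 p0 bc; pose C := p * expR (p * c).
have C0 : 0 <= C by rewrite mulr_ge0// expR_ge0.
exists (b 1%N `^ p + (C * (1 + c)) `^ p); first by rewrite addr_ge0// powR_ge0.
move=> n s n1 /andP[s0 s1]; set M := _ + _.
have M0 : 0 <= M by rewrite addr_ge0// powR_ge0.
have MP m : M <= M * P m s by rewrite ler_peMr// prod_1D_ge1.
elim: n n1 => // -[_ _|n /(_ isT) IHn _].
  apply: le_trans (MP 1%N); rewrite big_nat1 ler_wpDr ?powR_ge0//.
  rewrite ge0_ler_powR ?nnegrE ?mulr_ge0//; [by apply/ltW/b_gt0..|].
  by rewrite ler_piMl// ltW// b_gt0.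
have Bn0 : 0 < B n.+1 by exact: partial_sum_gt0.
have bn0 : 0 < b n.+2 by exact: b_gt0.
pose t := b n.+2 / B n.+1.
have t0 : 0 <= t by rewrite divr_ge0// ltW.
have tc : t <= c by rewrite ler_pdivrMr// bc.
have sBn : s * B n.+2 = s * B n.+1 * (1 + t).
  by rewrite big_nat_recr//= /t; field; rewrite gt_eqF.
have sB0 : 0 <= s * B n.+1 by rewrite mulr_ge0// ltW.
(* Beyond the threshold the new factor pays for the growth of the power;
   below it the power is still at most [(C * (1 + c)) `^ p]. *)
rewrite sBn; have [CsB|sBC] := leP C (s * B n.+1).
  rewrite powRM//; last lra.
  rewrite [leRHS](_ : _ = M * P n.+1 s * (1 + s * b n.+2)); last first.
    by rewrite big_nat_recr//= mulrA.
  rewrite ler_pM ?powR_ge0//.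
  apply: le_trans (powR_1D_le p0 t0 tc) _; rewrite lerD2l.
  apply: le_trans (ler_wpM2r t0 CsB) _.
  by rewrite /t le_eqVlt; apply/orP; left; apply/eqP; field; rewrite gt_eqF.
apply: le_trans (MP n.+2); rewrite ler_wpDl ?powR_ge0//.
rewrite ge0_ler_powR ?nnegrE ?mulr_ge0//; [lra..|].
by rewrite ler_pM//; lra.
Qed.

End Products.
End RealEstimates.

(** * Scalars and inner products *)

Section ScalarTheory.
Variables (R : realType) (k : scalar_kind).
Local Notation S := (scalars R k).
Implicit Types (a b : R) (z w : S).

Lemma of_realD a b : of_real k (a + b) = of_real k a + of_real k b.
Proof. by case: k => //=; rewrite rmorphD. Qed.

Lemma of_realM a b : of_real k (a * b) = of_real k a * of_real k b.
Proof. by case: k => //=; rewrite rmorphM. Qed.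

Lemma of_real0 : of_real k (0 : R) = 0.
Proof. by case: k. Qed.

Lemma of_real1 : of_real k (1 : R) = 1.
Proof. by case: k. Qed.

Lemma of_realX a n : of_real k (a ^+ n) = of_real k a ^+ n.
Proof. by case: k => //=; rewrite rmorphXn. Qed.

Lemma of_real_sum I (s : seq I) (P : pred I) (F : I -> R) :
  of_real k (\sum_(i <- s | P i) F i) = \sum_(i <- s | P i) of_real k (F i).
Proof. exact: (big_morph _ of_realD of_real0). Qed.

Lemma ler_of_real a b : (of_real k a <= of_real k b) = (a <= b).
Proof. by case: k => //=; rewrite lecR. Qed.

Lemma ltr_of_real a b : (of_real k a < of_real k b) = (a < b).
Proof. by case: k => //=; rewrite ltcR. Qed.

Lemma of_realK : cancel (@of_real R k) (@real_part R k).
Proof. by case: k. Qed.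

Lemma real_partK z : 0 <= z -> of_real k (real_part z) = z.
Proof.
move: z; rewrite /of_real /real_part; case: k => //= z /ger0_Im /=.
by case: z => a b /= ->.
Qed.

Lemma normr_of_real a : `|of_real k a| = of_real k `|a|.
Proof. by case: k => //=; rewrite normc_def /= expr0n addr0 sqrtr_sqr. Qed.

(** The norm of a scalar lies in the scalar field; this is its value in [R], as
    [hnorm] is for vectors. *)
Definition modulus z : R := real_part `|z|.

Lemma modulusE z : of_real k (modulus z) = `|z|.
Proof. exact: real_partK. Qed.

Lemma modulus_ge0 z : 0 <= modulus z.
Proof. by rewrite -ler_of_real modulusE of_real0. Qed.

Lemma modulusM z w : modulus (z * w) = modulus z * modulus w.
Proof. by apply: (can_inj of_realK); rewrite of_realM !modulusE normrM. Qed.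

Lemma modulus_of_real a : modulus (of_real k a) = `|a|.
Proof. by apply: (can_inj of_realK); rewrite modulusE normr_of_real. Qed.

Lemma sconjD z w : sconj (z + w) = sconj z + sconj w.
Proof. by move: z w; rewrite /sconj; case: k => //= z w; rewrite rmorphD. Qed.

Lemma sconj0 : sconj (0 : S) = 0.
Proof. by apply: (addrI (sconj 0)); rewrite -sconjD !addr0. Qed.

Lemma mul_sconj z : z * sconj z = `|z| ^+ 2.
Proof.
move: z; rewrite /sconj; case: k => /= z; last by rewrite sqr_normc.
by rewrite real_normK ?num_real.
Qed.

End ScalarTheory.

Section InnerProduct.
Variables (R : realType) (k : scalar_kind) (X : hilbert R k).
Implicit Types (x z : X) (c : scalars R k).

Lemma innerC x z : inner X x z = sconj (inner X z x).
Proof.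
have /= := @hermitian_subproof _ _ _ _ (inner X : Hermitian.type _ _ _) x z.
by rewrite expr0 mul1r.
Qed.

Lemma innerDl x y z : inner X (x + y) z = inner X x z + inner X y z.
Proof. exact: linearDl. Qed.

Lemma innerBl x y z : inner X (x - y) z = inner X x z - inner X y z.
Proof. exact: linearBl. Qed.

Lemma innerZl c x z : inner X (c *: x) z = c * inner X x z.
Proof. exact: (linearZl_LR (inner X)). Qed.

Lemma inner0l z : inner X 0 z = 0.
Proof. exact: linear0l. Qed.

Lemma inner_suml I (s : seq I) (P : pred I) (F : I -> X) z :
  inner X (\sum_(i <- s | P i) F i) z = \sum_(i <- s | P i) inner X (F i) z.
Proof. exact: (linear_sumlz (inner X)). Qed.

Lemma inner_sumr I (s : seq I) (P : pred I) (F : I -> X) z :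
  inner X z (\sum_(i <- s | P i) F i) = \sum_(i <- s | P i) inner X z (F i).
Proof. exact: (linear_sumr (inner X)). Qed.

Lemma innerDr x y z : inner X z (x + y) = inner X z x + inner X z y.
Proof. exact: linearDr. Qed.

Lemma innerZr c x z : inner X z (c *: x) = sconj c * inner X z x.
Proof. exact: (linearZr_LR (inner X)). Qed.

Lemma inner0C x z : inner X x z = 0 -> inner X z x = 0.
Proof. by move=> xz0; rewrite innerC xz0 sconj0. Qed.

Lemma hnormE x : of_real k (hnorm x) = `|x|.
Proof. exact: real_partK. Qed.

Lemma hnorm_ge0 x : 0 <= hnorm x.
Proof. by rewrite -(ler_of_real k) hnormE of_real0. Qed.

Lemma hnorm_sqrE x : of_real k (hnorm x ^+ 2) = inner X x x.
Proof. by rewrite of_realX hnormE innerE. Qed.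

Lemma ler_hnormD x z : hnorm (x + z) <= hnorm x + hnorm z.
Proof. by rewrite -(ler_of_real k) of_realD !hnormE ler_normD. Qed.

Lemma hnormZ c x : hnorm (c *: x) = modulus c * hnorm x.
Proof.
by apply: (can_inj (@of_realK R k)); rewrite of_realM modulusE !hnormE normrZ.
Qed.

Lemma pythagoras x z : inner X x z = 0 ->
  hnorm (x + z) ^+ 2 = hnorm x ^+ 2 + hnorm z ^+ 2.
Proof.
move=> xz0; apply: (can_inj (@of_realK R k)).
rewrite of_realD !hnorm_sqrE innerDl 2!innerDr xz0 (inner0C xz0).
by rewrite addr0 add0r.
Qed.

(** The norm of [X] is scalar-valued; radii can nevertheless be taken real. *)
Lemma hcvgP (u : nat -> X) (L : X) : u n @[n --> \oo] --> L <->
  forall eps : R, 0 < eps -> \forall n \near \oo, hnorm (L - u n) <= eps.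
Proof.
split=> [/cvgrPdist_le uL eps eps0|uL].
  have: 0 < of_real k eps by rewrite -(of_real0 R k) ltr_of_real.
  move=> /uL; apply: filterS => n.
  by rewrite -hnormE ler_of_real.
apply/cvgrPdist_le => eps eps0.
have : 0 < real_part eps.
  by rewrite -(ltr_of_real k) of_real0 real_partK// ltW.
move=> /uL; apply: filterS => n.
by rewrite -(ler_of_real k) (real_partK (ltW eps0)) hnormE.
Qed.

End InnerProduct.

(** * Orthonormal series *)

Section OrthonormalSeries.
Variables (R : realType) (k : scalar_kind) (X : hilbert R k).
Variables (A : set nat) (e : nat -> X).
Hypothesis e_orthonormal : forall m n, A m -> A n ->
  inner X (e m) (e n) = (m == n)%:R.
Implicit Types (x z : X) (c : nat -> scalars R k).

Definition fourier_sum c n : X := \sum_(0 <= m < n | m \in A) c m *: e m.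

Lemma inner_sum_e c i j m : A m ->
  inner X (\sum_(i <= l < j | l \in A) c l *: e l) (e m) =
  if (i <= m < j)%N then c m else 0.
Proof.
move=> Am; rewrite inner_suml (eq_bigr (fun l => if l == m then c m else 0)) => [|l].
  rewrite -big_mkcondr (eq_bigl (fun l => l == m)) ?big_nat1_eq// => l.
  by case: eqP => [->|]; rewrite ?andbF// mem_set.
rewrite inE => Al; rewrite innerZl e_orthonormal//.
by case: eqP => [->|]; rewrite ?mulr1 ?mulr0.
Qed.

Lemma hnorm_sum_e c i j :
  hnorm (\sum_(i <= l < j | l \in A) c l *: e l) ^+ 2 =
  \sum_(i <= l < j | l \in A) modulus (c l) ^+ 2.
Proof.
apply: (can_inj (@of_realK R k)); rewrite of_real_sum hnorm_sqrE inner_sumr.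
rewrite big_seq_cond [RHS]big_seq_cond; apply: eq_bigr => m /andP[].
rewrite mem_index_iota inE => mij Am; rewrite innerZr inner_sum_e// mij.
by rewrite mulrC mul_sconj of_realX modulusE.
Qed.

Lemma inner_fourier_sum c n m : A m -> (m < n)%N ->
  inner X (fourier_sum c n) (e m) = c m.
Proof. by move=> Am mn; rewrite inner_sum_e//= mn. Qed.

(** The partial Fourier sum is orthogonal to the remainder. *)
Lemma bessel x n :
  \sum_(0 <= m < n | m \in A) modulus (inner X x (e m)) ^+ 2 <= hnorm x ^+ 2.
Proof.
pose s := fourier_sum (fun m => inner X x (e m)) n.
have sxs : inner X s (x - s) = 0.
  rewrite inner_suml big_seq_cond big1// => m /andP[].
  rewrite mem_index_iota inE /= => mn Am; rewrite innerZl.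
  rewrite [X in _ * X]innerC innerBl inner_fourier_sum//.
  by rewrite subrr sconj0 mulr0.
rewrite -hnorm_sum_e -[X in _ <= hnorm X ^+ 2](subrK s) addrC pythagoras//.
by rewrite lerDl sqr_ge0.
Qed.

Lemma modulus_inner_le x m : A m -> modulus (inner X x (e m)) <= hnorm x.
Proof.
move=> Am; rewrite -(@ler_pXn2r _ 2)// ?nnegrE ?modulus_ge0 ?hnorm_ge0//.
apply: le_trans (bessel x m.+1); rewrite big_mkcond big_nat_recr//= mem_set//.
by rewrite lerDr sumr_ge0// => l _; case: ifP => // _; rewrite sqr_ge0.
Qed.

(** Riesz-Fischer: by orthogonality the increments of the partial sums have the
    norms of the tails of a convergent real series. *)
Lemma fourier_sum_cvg c (T : R) :
  (forall n, \sum_(0 <= m < n | m \in A) modulus (c m) ^+ 2 <= T) ->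
  cvgn (fourier_sum c).
Proof.
move=> cT; pose a m := if m \in A then modulus (c m) ^+ 2 else 0.
have a0 m : 0 <= a m by rewrite /a; case: ifP => // _; rewrite sqr_ge0.
have acvg : cvgn (series a).
  apply: nondecreasing_is_cvgn; first by apply: nondecreasing_series => n _ _.
  by exists T => _ [n _ <-]; rewrite /series/= -big_mkcond.
have -> : fourier_sum c = series (fun m => if m \in A then c m *: e m else 0).
  by apply/funext => n; rewrite /series /= -big_mkcond.
apply/cauchy_cvgP/cauchy_seriesP => eps eps0.
have eps'0 : 0 < real_part eps.
  by rewrite -(ltr_of_real k) of_real0 real_partK// ltW.
have /cauchy_cvgP/cauchy_seriesP/(_ _ (exprn_gt0 2 eps'0)) := acvg.
apply: filterS => -[i j] /=.
rewrite ger0_norm ?sumr_ge0// -!big_mkcond -hnorm_sum_e ltr_pXn2r ?nnegrE//.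
- by rewrite -(ltr_of_real k) (real_partK (ltW eps0)) hnormE.
- exact: hnorm_ge0.
- exact: ltW.
Qed.

(** Bessel's inequality for a single unit vector provides the continuity of
    the inner product in its first argument. *)
Lemma inner_cvg (u : nat -> X) L m : A m -> u n @[n --> \oo] --> L ->
  forall w, (\forall n \near \oo, inner X (u n) (e m) = w) ->
  inner X L (e m) = w.
Proof.
move=> Am /hcvgP uL w uw; apply/eqP; rewrite -subr_eq0 -normr_eq0 -modulusE.
rewrite -(of_real0 R k) (can_eq (@of_realK R k)) eq_le modulus_ge0 andbT.
apply/ler_addgt0Pr => eps eps0; rewrite add0r.
near \oo => n; have <- : inner X (u n) (e m) = w by near: n.
rewrite -innerBl; apply: le_trans (modulus_inner_le _ Am) _.
by near: n; apply: uL.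
Unshelve. all: by end_near. Qed.

Lemma inner_lim_fourier_sum c L m : A m ->
  fourier_sum c @ \oo --> L -> inner X L (e m) = c m.
Proof.
move=> Am cL; apply: (inner_cvg Am cL); near=> n; apply: inner_fourier_sum => //.
by near: n; apply: nbhs_infty_gt.
Unshelve. all: by end_near. Qed.

(** Membership in the closed linear span of the family, stated as convergence
    of the Fourier expansion. *)
Definition in_span x :=
  fourier_sum (fun m => inner X x (e m)) @ \oo --> x.

Lemma lim_fourier_sum_in_span c L :
  fourier_sum c @ \oo --> L -> in_span L.
Proof.
move=> cL; rewrite /in_span (_ : fourier_sum _ = fourier_sum c)//.
apply/funext => n; apply: eq_bigr => m; rewrite inE => Am.
by rewrite (inner_lim_fourier_sum Am cL).
Qed.

Lemma in_span0 : in_span 0.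
Proof.
apply: (@lim_fourier_sum_in_span (fun=> 0)).
rewrite [X in X @ _](_ : _ = fun=> 0); first exact: cvg_cst.
by apply/funext => n; rewrite /fourier_sum big1// => m _; rewrite scale0r.
Qed.

Lemma in_spanP a x z : in_span x -> in_span z -> in_span (a *: x + z).
Proof.
move=> xs zs; rewrite /in_span (_ : fourier_sum _ =
  fun n => a *: fourier_sum (fun m => inner X x (e m)) n +
           fourier_sum (fun m => inner X z (e m)) n).
  by apply: cvgD zs; apply: cvgZr.
apply/funext => n; rewrite /fourier_sum scaler_sumr -big_split/=.
by apply: eq_bigr => m _; rewrite innerDl innerZl scalerDl scalerA.
Qed.

(** The half of Parseval's identity that bounds the norm by the coefficients. *)
Lemma in_span_hnorm_le x (D : R) : in_span x -> 0 <= D ->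
  (forall n, \sum_(0 <= m < n | m \in A) modulus (inner X x (e m)) ^+ 2
     <= D ^+ 2) ->
  hnorm x <= D.
Proof.
move=> /hcvgP xs D0 xD; apply/ler_addgt0Pr => eps eps0.
have [n _ /(_ n (leqnn n)) /= xn] := xs _ eps0.
rewrite -[X in hnorm X](subrK (fourier_sum (fun m => inner X x (e m)) n)).
apply: (le_trans (ler_hnormD _ _)); rewrite addrC lerD//.
by rewrite -(@ler_pXn2r _ 2)// ?nnegrE ?hnorm_ge0// hnorm_sum_e.
Qed.

(** [tannery] applied to the squared coefficients of [phi n *: x n], dominated
    by the multiple [C ^+ 2] of the summable squared coefficients of [w]. *)
Lemma in_span_tannery (x : nat -> X) (w : X) (phi : nat -> R)
    (g : nat -> nat -> R) (C : R) :
  (forall n, in_span (x n)) -> (forall n, 0 <= phi n) ->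
  (forall n m, A m -> phi n * modulus (inner X (x n) (e m)) <=
     g n m * modulus (inner X w (e m))) ->
  (\forall n \near \oo, forall m, A m -> 0 <= g n m <= C) ->
  (forall m, A m -> g n m @[n --> \oo] --> 0) ->
  phi n * hnorm (x n) @[n --> \oo] --> 0.
Proof.
move=> xs phi0 xg gC g0; pose W m := modulus (inner X w (e m)).
pose a n m := if m \in A then (g n m * W m) ^+ 2 else 0.
have W0 m : 0 <= W m by exact: modulus_ge0.
have Wcvg : cvgn (series (fun m => if m \in A then (C * W m) ^+ 2 else 0)).
  apply: nondecreasing_is_cvgn.
    by apply: nondecreasing_series => n _ _; case: ifP => // _; exact: sqr_ge0.
  exists (C ^+ 2 * hnorm w ^+ 2) => _ [n _ <-]; rewrite /series/= -big_mkcond/=.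
  under eq_bigr do rewrite exprMn.
  by rewrite -mulr_sumr ler_wpM2l ?sqr_ge0//; exact: bessel.
have aC : \forall n \near \oo, forall m,
    0 <= a n m <= (if m \in A then (C * W m) ^+ 2 else 0).
  apply: filterS gC => n gC m; rewrite /a; case: ifPn => [|_]; last by rewrite lexx.
  rewrite inE => Am; have /andP[gn0 gnC] := gC _ Am.
  have C0 := le_trans gn0 gnC.
  rewrite sqr_ge0/=; apply: lerXn2r; rewrite ?nnegrE ?mulr_ge0 ?W0//.
  exact: ler_wpM2r.
have a0 m : a n m @[n --> \oo] --> 0.
  rewrite /a; have [|_] := boolP (m \in A); last exact: cvg_cst.
  rewrite inE => Am.
  have gW : g n m * W m @[n --> \oo] --> 0 * W m by apply: cvgMr_tmp; exact: g0.
  by have := cvgM gW gW; rewrite !mul0r; apply.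
apply/cvgrPdist_le => eps eps0.
apply: filterS2 (tannery Wcvg aC a0 (exprn_gt0 2 eps0)) gC => n aeps {}gC.
rewrite sub0r normrN ger0_norm ?mulr_ge0 ?hnorm_ge0//.
rewrite -[phi n](ger0_norm (phi0 n)) -(modulus_of_real k) -hnormZ.
apply: in_span_hnorm_le (ltW eps0) _.
  by rewrite -[X in in_span X]addr0; apply: in_spanP in_span0.
move=> N; apply: le_trans (aeps N); rewrite /a -big_mkcond/=.
apply: ler_sum => m; rewrite inE => Am; rewrite innerZl modulusM.
rewrite modulus_of_real ger0_norm//.
have /andP[gn0 _] := gC _ Am.
by apply: lerXn2r; rewrite ?nnegrE ?mulr_ge0 ?modulus_ge0 ?xg.
Qed.

End OrthonormalSeries.

(** [inner_cvg] for the one-element family formed by the normalization of [z]. *)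
Lemma orthogonal_limit (R : realType) (k : scalar_kind) (X : hilbert R k)
    (u : nat -> X) (L z : X) :
  u n @[n --> \oo] --> L -> (forall n, inner X (u n) z = 0) -> inner X L z = 0.
Proof.
move=> uL uz; have [->|z0] := eqVneq z 0; first by rewrite innerC inner0l sconj0.
have hz0 : of_real k (hnorm z) != 0 by rewrite hnormE normr_eq0.
pose e := (of_real k (hnorm z))^-1 *: z.
have ze : z = of_real k (hnorm z) *: e by rewrite scalerA mulfV// scale1r.
have e1 : inner X e e = 1.
  have := hnorm_sqrE z; rewrite [RHS](congr2 (inner X) ze ze) innerZl innerZr.
  rewrite mulrA mul_sconj normr_of_real ger0_norm ?hnorm_ge0// of_realX.
  by rewrite -[LHS]mulr1 => /mulfI -> //; rewrite expf_neq0.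
have e_on m n : [set 0%N] m -> [set 0%N] n -> inner X e e = (m == n)%:R.
  by move=> -> ->; rewrite e1.
rewrite ze innerZr (inner_cvg (A := [set 0%N]) e_on (m := 0%N) erefl uL (w := 0)).
  by rewrite mulr0.
near=> n; rewrite /e innerZr uz mulr0//.
Unshelve. all: by end_near. Qed.

(** * The singular system and the error *)

Section SingularSystem.
Variables (R : realType) (k : scalar_kind) (X Y : hilbert R k).
Variables (K : {linear X -> Y}) (SV : sve K).
Hypothesis K_norm : opnorm K = 1.

Local Notation A := (sidx SV).
Local Notation sigma := (sval_ SV).
Local Notation v := (rvec SV).
Local Notation u := (lvec SV).
Let v_on := @rvec_orthonormal _ _ _ _ _ SV.
Let u_on := @lvec_orthonormal _ _ _ _ _ SV.

Lemma hnorm_eq1 (Z : hilbert R k) (z : Z) :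
  inner Z z z = 1 -> hnorm z = 1.
Proof.
move=> z1; apply/eqP; rewrite -(@eqrXn2 _ 2)// ?hnorm_ge0//; apply/eqP.
by apply: (can_inj (@of_realK R k)); rewrite hnorm_sqrE z1 expr1n of_real1.
Qed.

(** A supremum equal to 1 is a genuine upper bound, since the supremum of an
    unbounded set is 0 by convention. *)
Lemma sval_le1 m : A m -> sigma m <= 1.
Proof.
move=> Am; have s0 := sval_gt0 Am.
set E := [set hnorm (K x) | x in [set x | hnorm x <= 1]].
have [hE|hE] := pselect (has_sup E); last first.
  by have := K_norm; rewrite /opnorm sup_out// => /esym/eqP; rewrite oner_eq0.
rewrite -K_norm; apply: (ub_le_sup hE.2); exists (v m) => /=.
  by rewrite hnorm_eq1// v_on// eqxx.
rewrite sve_right// hnormZ modulus_of_real gtr0_norm//.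
by rewrite hnorm_eq1 ?mulr1// u_on// eqxx.
Qed.

Lemma sval_pow_le1 m t : A m -> 0 <= t -> sigma m `^ t <= 1.
Proof.
move=> Am t0; have s0 := sval_gt0 Am.
have := ge0_ler_powR t0 _ _ (sval_le1 Am).
by rewrite !nnegrE powR1; apply => //; exact: ltW.
Qed.

(** Spectral multipliers between 0 and 1 preserve square summability; the
    limits in the definitions of the fractional powers exist for this reason. *)
Lemma multiplier_cvg (d : nat -> R) (c : nat -> scalars R k) (T : R) :
  (forall m, A m -> 0 <= d m <= 1) ->
  (forall n, \sum_(0 <= m < n | m \in A) modulus (c m) ^+ 2 <= T) ->
  cvgn (fourier_sum A v (fun m => of_real k (d m) * c m)).
Proof.
move=> d01 cT; apply: (fourier_sum_cvg v_on) => n; apply: le_trans (cT n).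
apply: ler_sum => m; rewrite inE => Am; have /andP[d0 d1] := d01 _ Am.
rewrite modulusM modulus_of_real ger0_norm// exprMn ler_piMl ?sqr_ge0//.
by rewrite expr_le1.
Qed.

Lemma normal_pow_cvg t x : 0 <= t ->
  fourier_sum A v (fun m => of_real k (sigma m `^ (2 * t)) * inner X x (v m))
    @ \oo --> normal_pow SV t x.
Proof.
move=> t0; apply: (multiplier_cvg (d := fun m => sigma m `^ (2 * t))) => [m Am|].
  by rewrite powR_ge0 sval_pow_le1// mulr_ge0.
by move=> n; exact: (bessel v_on).
Qed.

Lemma inner_normal_pow t x m : 0 <= t -> A m ->
  inner X (normal_pow SV t x) (v m) =
  of_real k (sigma m `^ (2 * t)) * inner X x (v m).
Proof.
by move=> t0 Am; rewrite (inner_lim_fourier_sum v_on Am (normal_pow_cvg t0)).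
Qed.

Lemma weighted_adjoint_cvg r y : 0 <= r ->
  fourier_sum A v (fun m => of_real k (sigma m `^ r) * inner Y y (u m))
    @ \oo --> weighted_adjoint SV r y.
Proof.
move=> r0; apply: (multiplier_cvg (d := fun m => sigma m `^ r)) => [m Am|].
  by rewrite powR_ge0 sval_pow_le1.
by move=> n; exact: (bessel u_on).
Qed.

Lemma inner_weighted_adjoint r y m : 0 <= r -> A m ->
  inner X (weighted_adjoint SV r y) (v m) =
  of_real k (sigma m `^ r) * inner Y y (u m).
Proof.
move=> r0 Am.
by rewrite (inner_lim_fourier_sum v_on Am (weighted_adjoint_cvg r0)).
Qed.

Lemma inner_K x m : A m ->
  inner Y (K x) (u m) = of_real k (sigma m) * inner X x (v m).
Proof.
by move=> Am; rewrite (inner_lim_fourier_sum u_on Am (@sve_expansion _ _ _ _ _ SV x)).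
Qed.

(** The orthogonal projection onto the closed span of the right singular
    vectors, that is onto the orthogonal complement of the kernel of [K]. *)
Definition v_proj (z : X) : X :=
  limn (fourier_sum A v (fun m => inner X z (v m))).

Lemma v_proj_cvg z :
  fourier_sum A v (fun m => inner X z (v m)) @ \oo --> v_proj z.
Proof. by apply: (fourier_sum_cvg v_on) => n; exact: (bessel v_on). Qed.

Lemma K_v_proj z : K (v_proj z) = K z.
Proof.
apply: (cvg_unique _ (@sve_expansion _ _ _ _ _ SV (v_proj z))) => //.
apply: cvg_trans (@sve_expansion _ _ _ _ _ SV z); apply: near_eq_cvg; near=> n.
apply: eq_bigr => m; rewrite inE => Am.
by rewrite (inner_lim_fourier_sum v_on Am (@v_proj_cvg z)).
Unshelve. all: by end_near. Qed.

(** [v_proj z] witnesses that [K z] lies in the domain of the pseudoinverse, so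
    the defining property holds; the residual [y'] is orthogonal to each
    [u m = K (v m) / sigma m]. *)
Lemma inner_pseudoinverse y m : range K y -> A m ->
  inner Y y (u m) = of_real k (sigma m) * inner X (pseudoinverse K y) (v m).
Proof.
move=> [z _ <-] Am; rewrite /pseudoinverse; set D := [set x | _].
have [_ [y' y'K ->]] : D (xget 0 D).
  apply: (@xgetI _ 0 D (v_proj z)); split=> [z' Kz'|]; last first.
    by exists 0 => [w|]; rewrite ?inner0l// addr0 K_v_proj.
  apply: (orthogonal_limit (@v_proj_cvg z)) => n.
  rewrite inner_suml big1// => l; rewrite inE => Al; rewrite innerZl.
  rewrite [X in _ * X](_ : _ = 0) ?mulr0//; apply: inner0C.
  have /eqP := inner_K z' Al; rewrite Kz' inner0l eq_sym mulf_eq0 => /orP[|/eqP//].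
  rewrite -(of_real0 R k) (can_eq (@of_realK R k)) gt_eqF//.
  exact: sval_gt0.
have y'u : inner Y y' (u m) = 0.
  rewrite innerC (_ : u m = of_real k (sigma m)^-1 *: K (v m)); last first.
    rewrite sve_right// scalerA -of_realM mulVf ?of_real1 ?scale1r//.
    by rewrite gt_eqF// sval_gt0.
  by rewrite innerZl innerC y'K !(sconj0, mulr0).
by rewrite innerDl y'u addr0 inner_K.
Qed.

Section NSIWTError.
Variables (alpha r : nat -> R) (y : Y) (nu : R) (x : nat -> X).
Hypotheses (alpha_gt0 : forall j, (1 <= j)%N -> 0 < alpha j)
  (r_gt0 : forall j, (1 <= j)%N -> 0 < r j)
  (y_attainable : range K y) (nu_gt0 : 0 < nu)
  (source : source_space SV nu (pseudoinverse K y))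
  (x_NSIWT : NSIWT SV alpha r y x).

Local Notation err n := (pseudoinverse K y - x n).

(** Every term of the iteration equation is a spectral expansion, and the
    equation can be solved for [x n] because [alpha n] is nonzero; the source
    condition places the pseudoinverse solution in the span. *)
Lemma err_in_span n : in_span A v (err n).
Proof.
have lim0 : in_span A v 0 := in_span0 v_on.
have xs j : in_span A v (x j).
  have [x0 xS] := x_NSIWT; elim: j => [|j IHj]; first by rewrite x0.
  have r0 : 0 < r j.+1 by exact: r_gt0.
  have a0 : of_real k (alpha j.+1) != 0.
    rewrite -(of_real0 R k) (can_eq (@of_realK R k)) gt_eqF//.
    exact: alpha_gt0.
  have -> : x j.+1 = (of_real k (alpha j.+1))^-1 *: (-1 *:
      normal_pow SV ((r j.+1 + 1) / 2) (x j.+1) +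
      (weighted_adjoint SV (r j.+1) y + of_real k (alpha j.+1) *: x j)) + 0.
    rewrite -(xS j.+1 isT) scaleN1r addrA addNr add0r scalerA mulVf// scale1r.
    by rewrite addr0.
  apply: in_spanP lim0; apply: in_spanP.
    by apply: lim_fourier_sum_in_span v_on _ _ (@normal_pow_cvg _ _ _); lra.
  rewrite addrC; apply: in_spanP => //.
  by apply: lim_fourier_sum_in_span v_on _ _ (@weighted_adjoint_cvg _ _ _); lra.
have [w _ <-] := source; rewrite addrC -scaleN1r; apply: in_spanP => //.
apply: lim_fourier_sum_in_span v_on _ _ (@normal_pow_cvg _ _ _).
by apply: divr_ge0 => //; apply: ltW.
Qed.

(** Pairing the iteration equation with [v m] gives a scalar recursion. *)
Lemma inner_err n m : A m ->
  inner X (err n) (v m) =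
  of_real k (damping alpha r (sigma m) n)^-1
  * inner X (pseudoinverse K y) (v m).
Proof.
move=> Am; have [x0 xS] := x_NSIWT.
have s0 := sval_gt0 Am.
elim: n => [|n IHn].
  by rewrite /damping x0 subr0 big_geq// invr1 of_real1 mul1r.
have r0 : 0 < r n.+1 by exact: r_gt0.
have a0 : 0 < alpha n.+1 by exact: alpha_gt0.
set S := sigma m `^ (r n.+1 + 1); set a := alpha n.+1 in a0 *.
set p := inner X (pseudoinverse K y) (v m).
have S0 : 0 <= S by exact: powR_ge0.
have step : of_real k (S + a) * inner X (err n.+1) (v m) =
            of_real k a * inner X (err n) (v m).
  have := congr1 (fun z => inner X z (v m)) (xS n.+1 isT); rewrite !innerBl.
  rewrite !innerDl !innerZl inner_normal_pow//; last lra.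
  rewrite inner_weighted_adjoint//; last lra.
  rewrite inner_pseudoinverse//= [2 * _]mulrCA mulfV// mulr1.
  rewrite [of_real k (_ `^ _) * (_ * _)]mulrA -of_realM.
  rewrite -[X in sigma m `^ r n.+1 * X]powRr1 ?(ltW s0)// -powRD; last first.
    by apply/implyP => _; rewrite gt_eqF.
  rewrite -/S -/a -/p of_realD => Sz.
  by rewrite mulrBr !mulrDl Sz mulrBr; ring.
have Sa0 : of_real k (S + a) != 0.
  by rewrite -(of_real0 R k) (can_eq (@of_realK R k)) gt_eqF//; lra.
apply: (mulfI Sa0); rewrite step IHn -/p !mulrA -!of_realM; congr (of_real k _ * _).
rewrite /damping [in RHS]big_nat_recr//= -/S -/a.
rewrite [in RHS]invfM (_ : (1 + S / a)^-1 = (S + a)^-1 * a); last first.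
  by field; rewrite !gt_eqF//; lra.
by rewrite mulrCA [X in _ = _ * X]mulrA mulfV ?mul1r 1?mulrC// gt_eqF//; lra.
Qed.

(** The element [w] of the source condition supplies the square-summable
    sequence, so only the spectral factors remain to be estimated. *)
Lemma err_decay (phi : nat -> R) (C : R) :
  (forall n, 0 <= phi n) ->
  (\forall n \near \oo, forall m, A m -> phi n * sigma m `^ nu /
     damping alpha r (sigma m) n <= C) ->
  (forall m, A m -> phi n * sigma m `^ nu /
     damping alpha r (sigma m) n @[n --> \oo] --> 0) ->
  phi n * hnorm (err n) @[n --> \oo] --> 0.
Proof.
move=> phi0 gC g0; have [w _ pw] := source.
have damping_ge0 n m : 0 <= (damping alpha r (sigma m) n)^-1.
  rewrite invr_ge0 /damping big_nat prodr_ge0// => j /andP[j1 _].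
  by rewrite addr_ge0// divr_ge0 ?powR_ge0// ltW// alpha_gt0.
apply: (in_span_tannery v_on (w := w) (C := C) err_in_span phi0 _ _ g0).
  move=> n m Am; rewrite inner_err// modulusM modulus_of_real ger0_norm//.
  rewrite -pw inner_normal_pow//; last by apply: divr_ge0 => //; apply: ltW.
  rewrite [2 * _]mulrCA mulfV// mulr1 modulusM modulus_of_real.
  by rewrite ger0_norm ?powR_ge0// !mulrA [phi n * _ * _ `^ _]mulrAC.
apply: filterS gC => n {}gC m Am; rewrite gC// andbT.
by rewrite !mulr_ge0 ?powR_ge0.
Qed.

End NSIWTError.
End SingularSystem.

(** * Convergence rates *)

Section Weights.
Variables (R : realType) (alpha : nat -> R).
Hypothesis alpha_gt0 : forall j, (1 <= j)%N -> 0 < alpha j.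

(** The finitely many indices before the eventual bound are handled by a minimum
    of positive numbers. *)
Lemma uniform_lower_bound (a : R) : 0 < a -> (\forall n \near \oo, a <= alpha n) ->
  exists2 a', 0 < a' & forall j, (1 <= j)%N -> a' <= alpha j.
Proof.
move=> a0 [N _ /= aN]; elim: N a a0 aN => [|N IHN] a a0 aN.
  by exists a => // j _; apply: aN.
case: (posnP N) aN => [->|N0] aN.
  by exists a => // j j1; apply: aN.
apply: (IHN (Num.min a (alpha N))); first by rewrite lt_min a0 alpha_gt0.
move=> n /=; rewrite leq_eqVlt => /predU1P[<-|/aN an].
  by rewrite ge_min lexx orbT.
by rewrite ge_min an.
Qed.

Lemma alpha_lim_pos_lower_bound : alpha_lim_pos alpha ->
  exists2 a, 0 < a & forall j, (1 <= j)%N -> a <= alpha j.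
Proof.
move=> [l l0 al].
have [a a0 lta] : exists2 a : R, 0 < a & (a%:E < l)%E.
  case: l l0 {al} => [l|_|//]; last by exists 1; rewrite ?ltry.
  by rewrite !lte_fin => l0; exists (l / 2); rewrite ?lte_fin; lra.
apply: (uniform_lower_bound a0).
have lnbhs : nbhs l [set z | (a%:E < z)%E].
  by apply: open_nbhs_nbhs; split => //; exact: open_ereal_gt_ereal.
have alta : \forall n \near \oo, (a%:E < (alpha n)%:E)%E := al _ lnbhs.
by apply: filterS alta => n /=; rewrite lte_fin => /ltW.
Qed.

(** If the sums of [1 / (1 + alpha j)] converged, then [alpha] would tend to
    infinity, hence be bounded below by some [a > 0], and
    [1 / alpha j <= (1 + 1 / a) / (1 + alpha j)] would bound [beta]. *)
Lemma beta_tilde_cvgy : beta alpha n @[n --> \oo] --> +oo ->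
  beta_tilde alpha n @[n --> \oo] --> +oo.
Proof.
move=> beta_oo.
have bt_series : beta_tilde alpha = series (fun j => (1 + alpha j.+1)^-1).
  by apply/funext => n; rewrite /beta_tilde/= /series/= big_add1.
have nd : nondecreasing_seq (beta_tilde alpha).
  rewrite bt_series; apply: nondecreasing_series => n _ _.
  by rewrite invr_ge0 addr_ge0// ltW// alpha_gt0.
apply: nondecreasing_dvgn_lt => // bt_cvg.
have [a a0 aalpha] : exists2 a, 0 < a & forall j, (1 <= j)%N -> a <= alpha j.
  have := bt_cvg; rewrite bt_series => /cvg_series_cvg_0.
  have half : 0 < 2^-1 :> R by lra.
  move=> /cvgrPdist_le/(_ _ half)[N _ aN].
  apply: (@uniform_lower_bound 1) => //; exists N.+1 => // -[//|n] /= Nn.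
  have an : 0 < alpha n.+1 by exact: alpha_gt0.
  have := aN n Nn; rewrite sub0r normrN ger0_norm; last first.
    by rewrite invr_ge0; lra.
  by rewrite lef_pV2 ?posrE//; lra.
have le_beta n : beta alpha n <= (1 + a^-1) * beta_tilde alpha n.
  rewrite /beta /beta_tilde mulr_sumr big_nat [leRHS]big_nat.
  apply: ler_sum => j /andP[j1 _]; have aj := aalpha _ j1.
  have aj0 := alpha_gt0 j1.
  rewrite ler_pdivlMr; last lra.
  rewrite mulrDr mulr1 mulVf ?gt_eqF// [leRHS]addrC lerD2r.
  by rewrite lef_pV2 ?posrE.
have /cvgryPge/(_ ((1 + a^-1) * (limn (beta_tilde alpha)) + 1)) [N _ bN] := beta_oo.
have := bN N (leqnn N); apply/negP; rewrite -ltNge.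
apply: le_lt_trans (le_beta N) _.
have a1 : 0 <= 1 + a^-1 by rewrite addr_ge0// invr_ge0 ltW.
rewrite ltr_pwDr// ler_wpM2l//.
exact: nondecreasing_cvgn_le.
Qed.

End Weights.

Lemma ger0_cvg0 (R : realType) (f : nat -> R) : (forall n, 0 <= f n) ->
  (forall eps, 0 < eps -> \forall n \near \oo, f n <= eps) ->
  f n @[n --> \oo] --> 0.
Proof.
move=> f0 feps; apply/cvgrPdist_le => eps /feps.
by apply: filterS => n; rewrite sub0r normrN ger0_norm.
Qed.

Section Rates.
Variables (R : realType) (k : scalar_kind) (X Y : hilbert R k).
Variables (K : {linear X -> Y}) (SV : sve K).
Hypothesis K_norm : opnorm K = 1.
Variables (alpha r : nat -> R) (y : Y) (nu : R) (x : nat -> X).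
Hypotheses (alpha_gt0 : forall j, (1 <= j)%N -> 0 < alpha j)
  (r_gt0 : forall j, (1 <= j)%N -> 0 < r j)
  (y_attainable : range K y) (nu_gt0 : 0 < nu)
  (source : source_space SV nu (pseudoinverse K y))
  (x_NSIWT : NSIWT SV alpha r y x).

Local Notation A := (sidx SV).
Local Notation sigma := (sval_ SV).
Local Notation err n := (pseudoinverse K y - x n).

(** The uniform bound on the spectral factors comes from [powR_sum_le_prod] with
    the exponent [p], the pointwise decay from the exponent [p + 1].  The weights
    [b] replace [1 / alpha] so that [1 / (1 + alpha)] is covered too. *)
Lemma controlled_rate (b : nat -> R) (c rho : R) :
  (forall j, (1 <= j)%N -> 0 < b j) ->
  (forall j, (1 <= j)%N -> b j <= (alpha j)^-1) ->
  0 <= c ->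
  (forall n, (2 <= n)%N -> b n <= c * \sum_(1 <= j < n) b j) ->
  \sum_(1 <= j < n.+1) b j @[n --> \oo] --> +oo ->
  0 <= rho -> (forall j, (1 <= j)%N -> r j <= rho) ->
  (\sum_(1 <= j < n.+1) b j) `^ (nu / (rho + 1)) * hnorm (err n)
    @[n --> \oo] --> 0.
Proof.
move=> b_gt0 b_le c0 bc b_oo rho0 r_le; set p := nu / (rho + 1).
have p0 : 0 <= p by apply: divr_ge0; [exact: ltW|exact: addr_ge0].
have bc' n : (2 <= n)%N -> b n <= c * \sum_(1 <= j < n.-1.+1) b j.
  by case: n => // n n2; exact: bc.
have [M M0 HM] := powR_sum_le_prod b_gt0 c0 p0 bc'.
have [|M' M'0 HM'] := powR_sum_le_prod b_gt0 c0 (p := p + 1) _ bc'; first lra.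
pose B n := \sum_(1 <= j < n.+1) b j.
have B0 n : 0 <= B n.
  by rewrite /B big_nat sumr_ge0// => j /andP[/b_gt0/ltW].
pose G m n := damping alpha r (sigma m) n.
pose s m := sigma m `^ (rho + 1).
have s01 m : A m -> 0 <= s m <= 1.
  by move=> Am; rewrite powR_ge0 sval_pow_le1// addr_ge0.
have sp m : A m -> sigma m `^ nu = s m `^ p.
  by move=> Am; rewrite -powRrM mulrC divfK// gt_eqF//; lra.
have PG m n : A m -> \prod_(1 <= j < n.+1) (1 + s m * b j) <= G m n.
  move=> Am; rewrite /G /damping big_nat [leRHS]big_nat.
  apply: ler_prod => j /andP[j1 _]; have bj := b_gt0 _ j1.
  have /andP[sm0 _] := s01 _ Am.
  rewrite addr_ge0 ?mulr_ge0 ?(ltW bj)//= lerD2l ler_pM ?(ltW bj) ?b_le//.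
  by rewrite ger_powR ?sval_gt0 ?sval_le1// lerD2r r_le.
have G0 m n : A m -> 0 < G m n.
  move=> Am; apply: lt_le_trans (PG _ _ Am); apply: lt_le_trans ltr01 _.
  by apply: prod_1D_ge1 => //; have /andP[] := s01 _ Am.
apply: (err_decay K_norm alpha_gt0 r_gt0 y_attainable nu_gt0 source x_NSIWT
  (C := M)).
- by move=> n; exact: powR_ge0.
- near=> n => m Am; rewrite -/(G m n) ler_pdivrMr ?G0// sp// mulrC.
  have /andP[sm0 sm1] := s01 _ Am.
  rewrite -powRM //; last exact: B0.
  apply: le_trans (HM n (s m) _ (s01 _ Am)) _.
    by near: n; exact: nbhs_infty_ge.
  by rewrite ler_wpM2l// PG.
- move=> m Am; apply: ger0_cvg0 => [n|eps eps0].
    by rewrite divr_ge0 ?mulr_ge0 ?powR_ge0// ltW// G0.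
  have sm0 : 0 < s m by rewrite powR_gt0// sval_gt0.
  have := b_oo => /cvgryPge/(_ (M' / (s m * eps))) B_large.
  near=> n; have n1 : (1 <= n)%N by near: n; exact: nbhs_infty_ge.
  have Bn : 0 < B n by exact: partial_sum_gt0.
  rewrite -/(G m n) ler_pdivrMr ?G0// sp// mulrC.
  rewrite -(powRM _ (ltW sm0) (ltW Bn)).
  have sB0 : 0 < s m * B n by exact: mulr_gt0.
  rewrite -(ler_pM2r sB0).
  have := HM' n (s m) n1 (s01 _ Am).
  rewrite powRD; last by apply/implyP => _; rewrite gt_eqF.
  rewrite (powRr1 (ltW sB0)) => /le_trans; apply.
  have M'B : M' <= eps * (s m * B n).
    have : M' / (s m * eps) <= B n by near: n.
    by rewrite ler_pdivrMr ?mulr_gt0//; lra.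
  rewrite [leRHS]mulrAC ler_pM//; last exact: PG.
  by apply: le_trans ler01 _; apply: prod_1D_ge1 => //; exact: ltW.
Unshelve. all: by end_near. Qed.

Lemma powR_le_1D (t p : R) : 0 <= t -> 0 <= p <= 1 -> t `^ p <= 1 + t.
Proof.
move=> t0 /andP[p0 p1]; have [t1|t1] := leP t 1.
  apply: (@le_trans _ _ 1); last lra.
  have := ge0_ler_powR p0 _ _ t1.
  by rewrite !nnegrE powR1; apply.
apply: (@le_trans _ _ (t `^ 1)); first by rewrite ler_powR// ltW.
by rewrite powRr1//; lra.
Qed.

(** The exponents [nu / (r n + 1)] tend to 0, so eventually they are at most
    [1/2]; one factor [1 + t] of the product then suffices. *)
Lemma unbounded_order_rate :
  (forall i j, (1 <= i)%N -> (i <= j)%N -> r i <= r j) ->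
  r n @[n --> \oo] --> +oo ->
  (forall s, spectrum SV s -> s <> 0 ->
    forall eps, 0 < eps ->
      \forall n \near \oo, (beta alpha n)^-1 <= eps * s `^ (r n + 1)) ->
  beta alpha n `^ (nu / (r n + 1)) * hnorm (err n) @[n --> \oo] --> 0.
Proof.
move=> r_mono r_oo beta_o.
have ia_gt0 j : (1 <= j)%N -> 0 < (alpha j)^-1.
  by move=> j1; rewrite invr_gt0 alpha_gt0.
pose G m n := damping alpha r (sigma m) n.
pose t m n := sigma m `^ (r n + 1) * beta alpha n.
have t_gt0 m n : A m -> (1 <= n)%N -> 0 < t m n.
  by move=> Am n1; rewrite mulr_gt0 ?powR_gt0 ?sval_gt0// partial_sum_gt0.
have tG m n : A m -> (1 <= n)%N -> 1 + t m n <= G m n.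
  move=> Am n1; apply: le_trans (prod_1D_ge ia_gt0 _ (powR_ge0 _ _)) _.
  rewrite /G /damping big_nat [leRHS]big_nat; apply: ler_prod => j /andP[j1 jn].
  have aj := ia_gt0 _ j1.
  rewrite addr_ge0 ?mulr_ge0 ?(ltW aj) ?powR_ge0//= lerD2l.
  apply: ler_wpM2r; first exact: ltW.
  by rewrite ger_powR ?sval_gt0 ?sval_le1// lerD2r r_mono.
have tp m n : A m -> (1 <= n)%N ->
    beta alpha n `^ (nu / (r n + 1)) * sigma m `^ nu =
    t m n `^ (nu / (r n + 1)).
  move=> Am n1; have rn := r_gt0 n1.
  rewrite powRM ?powR_ge0//; last exact/ltW/partial_sum_gt0.
  by rewrite -powRrM [(r n + 1) * _]mulrC divfK 1?mulrC// gt_eqF//; lra.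
have r_large : \forall n \near \oo, 2 * nu <= r n.
  by move: r_oo => /cvgryPge; apply.
have p_small n : (1 <= n)%N -> 2 * nu <= r n -> 0 <= nu / (r n + 1) <= 2^-1.
  move=> n1 rn; have rn0 := r_gt0 n1; rewrite divr_ge0/=; [|exact: ltW|lra].
  by rewrite ler_pdivrMr; lra.
apply: (err_decay K_norm alpha_gt0 r_gt0 y_attainable nu_gt0 source x_NSIWT
  (C := 1)).
- by move=> n; exact: powR_ge0.
- near=> n => m Am.
  have n1 : (1 <= n)%N by near: n; exact: nbhs_infty_ge.
  have t0 := t_gt0 m n Am n1; have tGn := tG m n Am n1.
  rewrite -/(G m n) tp// ler_pdivrMr ?mul1r; last lra.
  apply: le_trans tGn; apply: powR_le_1D; first exact: ltW.
  have /andP[-> /le_trans ->//] : 0 <= nu / (r n + 1) <= 2^-1.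
    by apply: p_small => //; near: n.
  lra.
- move=> m Am; apply: ger0_cvg0 => [n|eps eps0].
    rewrite divr_ge0 ?mulr_ge0 ?powR_ge0// /damping big_nat prodr_ge0//.
    move=> j /andP[j1 _].
    by rewrite addr_ge0// mulr_ge0 ?powR_ge0// ltW// ia_gt0.
  have spec : spectrum SV (sigma m) by apply: subset_closure; exists m.
  have s0 := sval_gt0 Am.
  have := beta_o _ spec (elimN eqP (lt0r_neq0 s0)) => beta_m.
  (* [t >= 1] allows raising the exponent to [1/2], and [t >= eps ^- 2] makes
     [t `^ (1/2) <= eps * t]. *)
  have d0 : 0 < Num.min 1 (eps ^+ 2) by rewrite lt_min ltr01 exprn_gt0.
  near=> n.
  have n1 : (1 <= n)%N by near: n; exact: nbhs_infty_ge.
  have t0 := t_gt0 m n Am n1; have tGn := tG m n Am n1.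
  rewrite -/(G m n) tp// ler_pdivrMr; last lra.
  have bn : 0 < beta alpha n by exact: partial_sum_gt0.
  have t_large : 1 <= Num.min 1 (eps ^+ 2) * t m n.
    rewrite /t mulrA -ler_pdivrMr// div1r.
    by near: n; exact: beta_m.
  have t1 : 1 <= t m n.
    by apply: le_trans t_large _; rewrite ler_piMl ?(ltW t0)// ge_min lexx.
  have te : 1 <= eps ^+ 2 * t m n.
    by apply: le_trans t_large _; rewrite ler_wpM2r ?(ltW t0)// ge_min lexx orbT.
  have /andP[_ ple] : 0 <= nu / (r n + 1) <= 2^-1.
    by apply: p_small => //; near: n.
  apply: le_trans (ler_powR t1 ple) _.
  set q := t m n `^ 2^-1.
  have q0 : 0 < q by exact: powR_gt0.
  have qq : q * q = t m n.
    rewrite -powRD; last by apply/implyP => _; rewrite gt_eqF.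
    have -> : 2^-1 + 2^-1 = 1 :> R by lra.
    by rewrite powRr1// ltW.
  have eq1 : 1 <= eps * q.
    rewrite -(@ler_pXn2r _ 2)// ?nnegrE ?mulr_ge0 ?(ltW eps0) ?(ltW q0)//.
    by rewrite expr1n exprMn [q ^+ 2]expr2 qq.
  apply: (@le_trans _ _ (eps * t m n)).
    by rewrite -qq mulrA ler_peMl// (ltW q0).
  by rewrite ler_wpM2l ?(ltW eps0)//; lra.
Unshelve. all: by end_near. Qed.

End Rates.

(** * Landau notation and conclusion *)

Lemma eqo_powRN (R : realType) (e B p : nat -> R) :
  (forall n, 0 <= e n) -> (forall n, (1 <= n)%N -> 0 < B n) ->
  B n `^ p n * e n @[n --> \oo] --> 0 ->
  e =o_\oo (fun n => B n `^ (- p n)).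
Proof.
move=> e0 B0 /cvgrPdist_le eB; apply/eqoP => eps eps0; near=> n.
have Bn : 0 < B n by apply: B0; near: n; exact: nbhs_infty_ge.
have Bp : 0 < B n `^ p n by exact: powR_gt0.
rewrite powRN !ger0_norm ?invr_ge0 ?powR_ge0// ler_pdivlMr// mulrC.
have : `|0 - B n `^ p n * e n| <= eps by near: n; exact: eB.
by rewrite sub0r normrN ger0_norm// mulr_ge0// ltW.
Unshelve. all: by end_near. Qed.

Lemma eqO_of_eqo (R : realType) (f g : nat -> R) :
  f =o_\oo g -> f =O_\oo g.
Proof.
move=> /eqoP/(_ 1 ltr01) fg; apply/eqOP; near=> c.
apply: filterS fg => n; rewrite mul1r => /le_trans; apply.
by rewrite ler_peMl//; near: c; exact: nbhs_pinfty_ge.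
Unshelve. all: by end_near. Qed.

Theorem corollary27 (R : realType) (k : scalar_kind) (X Y : hilbert R k)
    (K : {linear X -> Y}) (SV : sve K) (alpha r : nat -> R) (y : Y) (nu : R)
    (x : nat -> X)
    (K_compact : compact_operator K)
    (K_norm : opnorm K = 1)
    (alpha_gt0 : forall j, (1 <= j)%N -> 0 < alpha j)
    (r_gt0 : forall j, (1 <= j)%N -> 0 < r j)
    (y_attainable : range K y)
    (nu_gt0 : 0 < nu)
    (source : source_space SV nu (pseudoinverse K y))
    (x_NSIWT : NSIWT SV alpha r y x) :
  let err := fun n => hnorm (pseudoinverse K y - x n) in
  (forall rho : R, 0 <= rho ->
    ereal_sup [set (r j)%:E | j in [set j | (1 <= j)%N]] = rho%:E ->
    beta alpha n @[n --> \oo] --> +oo ->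
    [/\ alpha_lim_pos alpha ->
          err =o_\oo (fun n => beta alpha n `^ (- (nu / (rho + 1)))),
        alpha_lim0_controlled alpha ->
          err =O_\oo (fun n => beta alpha n `^ (- (nu / (rho + 1)))) &
        ~ alpha_lim_pos alpha -> ~ alpha_lim0_controlled alpha ->
          err =o_\oo (fun n => beta_tilde alpha n `^ (- (nu / (rho + 1))))])
  /\
  ((forall i j, (1 <= i)%N -> (i <= j)%N -> r i <= r j) ->
   r n @[n --> \oo] --> +oo ->
   (forall s, spectrum SV s -> s <> 0 ->
      (fun n => ((beta alpha n)^-1)%R) =o_\oo (fun n => s `^ (r n + 1))) ->
   err =o_\oo (fun n => beta alpha n `^ (- (nu / (r n + 1))))).
Proof.
move=> err.
have err_ge0 n : 0 <= err n by exact: hnorm_ge0.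
have ia_gt0 j : (1 <= j)%N -> 0 < (alpha j)^-1.
  by move=> j1; rewrite invr_gt0 alpha_gt0.
have beta_gt0 n : (1 <= n)%N -> 0 < beta alpha n.
  exact: partial_sum_gt0 ia_gt0 n.
split=> [rho rho0 sup_r beta_oo|r_mono r_oo beta_o]; last first.
  apply: (eqo_powRN err_ge0 beta_gt0).
  apply: (unbounded_order_rate K_norm alpha_gt0 r_gt0 y_attainable nu_gt0 source
    x_NSIWT r_mono r_oo) => s sp /eqP s0 eps eps0.
  have /eqoP/(_ eps eps0)[N _ beta_N] := beta_o s sp (elimN eqP s0).
  exists N => // n /beta_N /=; rewrite (ger0_norm (powR_ge0 _ _)).
  exact: (le_trans (ler_norm _)).
have r_le j : (1 <= j)%N -> r j <= rho.
  by move=> j1; rewrite -lee_fin -sup_r; apply: ereal_sup_ubound; exists j.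
have controlled_eqo c : 0 <= c ->
    (forall n, (2 <= n)%N -> (alpha n)^-1 <= c * beta alpha n.-1) ->
    err =o_\oo (fun n => beta alpha n `^ (- (nu / (rho + 1)))).
  move=> c0 a_le; apply: (eqo_powRN err_ge0 beta_gt0).
  apply: (controlled_rate K_norm alpha_gt0 r_gt0 y_attainable nu_gt0 source
    x_NSIWT (b := fun j => (alpha j)^-1) ia_gt0 _ c0) => //.
  by case=> // n n2; exact: a_le.
split=> [/(alpha_lim_pos_lower_bound alpha_gt0)[a a0 a_le]|[_ [c c0 a_le]]|_ _].
- have a10 : 0 < alpha 1%N by exact: alpha_gt0.
  (* [1 / alpha n <= 1 / a = (alpha 1 / a) * (1 / alpha 1)], and [1 / alpha 1] is
     a term of the sum [beta alpha n.-1]. *)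
  apply: (controlled_eqo (alpha 1%N / a)); first by rewrite divr_ge0// ltW.
  case=> // n n2; rewrite /= mulrAC ler_pdivlMr//.
  apply: (@le_trans _ _ 1).
    by rewrite mulrC ler_pdivrMr ?alpha_gt0// mul1r a_le// ltnW.
  by rewrite -(ler_pM2l (ia_gt0 1%N isT)) mulrA mulVf ?gt_eqF// mul1r mulr1
    (partial_sum_ge ia_gt0).
- by apply: eqO_of_eqo; apply: controlled_eqo (ltW c0) a_le.
have it_gt0 j : (1 <= j)%N -> 0 < (1 + alpha j)^-1.
  by move=> j1; rewrite invr_gt0 addr_gt0// alpha_gt0.
have bt_gt0 n : (1 <= n)%N -> 0 < beta_tilde alpha n.
  exact: partial_sum_gt0 it_gt0 n.
apply: (eqo_powRN err_ge0 bt_gt0).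
(* The weights [1 / (1 + alpha n)] are at most 1, hence at most [1 + alpha 1]
   times the first of them. *)
have c0 : 0 <= 1 + alpha 1%N by rewrite addr_ge0// ltW// alpha_gt0.
apply: (controlled_rate K_norm alpha_gt0 r_gt0 y_attainable nu_gt0 source
  x_NSIWT (b := fun j => (1 + alpha j)^-1) it_gt0 _ c0) => //.
- move=> j j1; have aj := alpha_gt0 _ j1.
  by rewrite lef_pV2 ?posrE//; lra.
- case=> // n n2; have an : 0 < alpha n.+1 by exact: alpha_gt0.
  apply: (@le_trans _ _ 1); first by rewrite invf_le1; lra.
  have a1 : 0 < 1 + alpha 1%N by rewrite addr_gt0// alpha_gt0.
  rewrite -(ler_pM2l (it_gt0 1%N isT)) mulKf ?(gt_eqF a1)// mulr1.
  exact: (partial_sum_ge it_gt0).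
- exact: beta_tilde_cvgy.
Unshelve. all: by end_near. Qed.
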